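(* Let $\kappa$ be a strongly inaccessible cardinal, let $S\subseteq\kappa$ be a non-reflecting stationary set, and assume $\diamondsuit_S$ holds. Then $\mathrm{HL}^+_{2,\theta}[\kappa]$ fails for each $2\le\theta<\kappa$.
   Context: $S\subseteq\kappa$ is non-reflecting if there is no $\gamma<\kappa$ of uncountable cofinality with $S\cap\gamma$ stationary in $\gamma$. Notation: ${}^{\kappa>}2=\bigcup_{\alpha<\kappa}{}^{\alpha}2$; $\mathrm{lg}(\eta)$ is the length of $\eta$; $\eta\trianglelefteq\nu$ means $\eta$ is an initial segment of $\nu$, $\eta\triangleleft\nu$ a proper initial segment. A subtree $T\subseteq{}^{\kappa>}2$ (nonempty, closed under initial segments) is regular if (1) for all $\eta\in T$ and $\alpha<\kappa$ there is $\nu\in T$ with $\eta\trianglelefteq\nu$ and $\mathrm{lg}(\nu)=\max\{\mathrm{lg}(\eta),\alpha\}$, and (2) whenever $\delta<\kappa$ is a limit and $\eta\in{}^{\delta}2$ has $\eta\restriction\alpha\in T$ for all $\alpha<\delta$, then $\eta\in T$. A triple $(\kappa,T,A)$ is suitable if $A\in[\kappa]^\kappa$, $T$ is a regular subtree of ${}^{\kappa>}2$, and for $\eta\in T\cap{}^{\alpha}2$: $\{\eta^\frown0,\eta^\frown1\}\subseteq T$ iff $\alpha\in A$. $\mathrm{HL}^+_{n,\theta}[\kappa]$ is the statement: for every sequence $\langle<_\alpha:\alpha<\kappa\rangle$ with $<_\alpha$ a well-ordering of ${}^{\alpha}2$ and every coloring $c:\bigcup\{[{}^{\alpha}2]^n:\alpha<\kappa\}\to\theta$,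 there is a suitable triple $(\kappa,T,A)$ such that whenever $\alpha<\kappa$ and $\eta_0,\dots,\eta_{n-1}\in T\cap{}^{\alpha}2$ are pairwise distinct, $c$ omits at least one color of $\theta$ on the set of tuples $(\nu_0,\dots,\nu_{n-1})$ with $\eta_\ell\triangleleft\nu_\ell\in T$ for all $\ell<n$, $\mathrm{lg}(\nu_0)=\dots=\mathrm{lg}(\nu_{n-1})\in A$, and $\nu_0<_{\mathrm{lg}(\nu_0)}\dots<_{\mathrm{lg}(\nu_0)}\nu_{n-1}$. *)

(* Defs.v *)
From HB Require Import structures.
From mathcomp Require Import all_boot all_order.
From mathcomp Require Import boolp classical_sets functions cardinality.
From mathcomp Require wochoice.

Set Implicit Arguments.
Unset Strict Implicit.
Unset Printing Implicit Defensive.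

Import Order.TTheory.

Local Open Scope order_scope.
Local Open Scope classical_set_scope.
Local Open Scope card_scope.

(* An ordinal kappa is represented by a (well-)ordered type K of order type
   kappa: the ordinals alpha < kappa are the elements of K, and alpha,
   as the set of smaller ordinals, is [below alpha] (a set) or [seg alpha]
   (a type). *)

Definition card_lt (T U : Type) (A : set T) (B : set U) : Prop :=
  A #<= B /\ ~ (B #<= A).

Definition nsubset (n : nat) (T : Type) : Type := {X : set T | X #= `I_n}.

Section Ordinals.
Context {d : Order.disp_t} {K : orderType d}.
Implicit Types (a b g x : K) (D X C S : set K).

Definition below a : set K := [set x | x < a].

Definition seg a : Type := {x : K | x < a}.

Definition is_limit a : Prop :=
  (exists x, x < a) /\ forall x, x < a -> exists2 y, x < y & y < a.

Definition is_succ a b : Prop := a < b /\ forall x, a < x -> b <= x.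

(* In the next four definitions D stands for an ordinal <= kappa: either
   [below g] or [setT]. *)
Definition cofinal D X : Prop :=
  X `<=` D /\ forall a, D a -> exists2 b, X b & a <= b.

Definition closed_in D C : Prop :=
  forall g, D g -> is_limit g -> cofinal (below g) (C `&` below g) -> C g.

Definition club D C : Prop := cofinal D C /\ closed_in D C.

Definition stationary D S : Prop :=
  S `<=` D /\ forall C, club D C -> S `&` C !=set0.

(* Zero and successors have a finite cofinal subset, so they are excluded. *)
Definition uncountable_cofinality g : Prop :=
  forall X, cofinal (below g) X -> ~ countable X.

Definition nonreflecting S : Prop :=
  ~ exists g, uncountable_cofinality g /\ stationary (below g) (S `&` below g).

Definition diamond S : Prop :=
  exists2 A : K -> set K, (forall a, S a -> A a `<=` below a) &
    forall X, stationary setT [set a | S a /\ X `&` below a = A a].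

End Ordinals.

Arguments seg {d K} a.

Section Inaccessible.
Context {d : Order.disp_t} (K : orderType d).

Definition is_cardinal : Prop :=
  wochoice.well_order (<=%O : rel K) /\
  forall a : K, card_lt (below a) [set: K].

Definition is_regular_cardinal : Prop :=
  is_cardinal /\ forall X : set K, cofinal setT X -> X #= [set: K].

Definition is_strong_limit : Prop :=
  forall a : K, card_lt [set: set (seg a)] [set: K].

Definition strongly_inaccessible : Prop :=
  [/\ is_regular_cardinal, ~ countable [set: K] & is_strong_limit].

End Inaccessible.

Section Trees.
Context {d : Order.disp_t} {K : orderType d}.
Implicit Types (a b : K).

Definition bseq a : Type := seg a -> bool.

Definition restr a b (ab : a <= b) (nu : bseq b) : bseq a :=
  fun x => nu (exist _ (val x) (lt_le_trans (valP x) ab)).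

Definition initial a b (eta : bseq a) (nu : bseq b) : Prop :=
  exists ab : a <= b, eta = restr ab nu.

Definition proper_initial a b (eta : bseq a) (nu : bseq b) : Prop :=
  a < b /\ initial eta nu.

(* Meant for b the successor of a: eta followed by the single value i. *)
Definition append a b (eta : bseq a) (i : bool) : bseq b :=
  fun x => if (insub (val x) : option (seg a)) is Some y then eta y else i.
Arguments append {a} b eta i.

(* A subset of the binary sequences of length < kappa, level by level. *)
Definition seqset : Type := forall a : K, set (bseq a).

Definition is_subtree (T : seqset) : Prop :=
  (exists a (eta : bseq a), T a eta) /\
  forall a b (eta : bseq a) (nu : bseq b), initial eta nu -> T b nu -> T a eta.

Definition regular_subtree (T : seqset) : Prop :=
  [/\ is_subtree T,
      forall a (eta : bseq a) b, T a eta ->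
        exists2 nu : bseq (Order.max a b), T _ nu & initial eta nu
    & forall g (eta : bseq g), is_limit g ->
        (forall a (ag : a < g), T a (restr (ltW ag) eta)) -> T g eta].

Definition suitable (T : seqset) (A : set K) : Prop :=
  [/\ A #= [set: K], regular_subtree T &
      forall a (eta : bseq a) b, T a eta -> is_succ a b ->
        (forall i, T b (append b eta i)) <-> A a].

(* [le_ a] is the reflexive version of the well-ordering <_a of the sequences
   of length a; [X] below is the unordered version of the tuple [nu]. *)
Definition HLplus (n : nat) (theta : K) : Prop :=
  forall (le_ : forall a, rel (bseq a))
         (c : forall a, nsubset n (bseq a) -> seg theta),
    (forall a, wochoice.well_order (le_ a)) ->
    exists (T : seqset) (A : set K), suitable T A /\
      forall a (eta : 'I_n -> bseq a),
        (forall l, T a (eta l)) -> injective eta ->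
        exists i : seg theta,
          forall b (nu : 'I_n -> bseq b) (X : nsubset n (bseq b)),
            A b ->
            (forall l, proper_initial (eta l) (nu l) /\ T b (nu l)) ->
            (forall l m : 'I_n, (l < m)%N ->
               le_ b (nu l) (nu m) /\ nu l <> nu m) ->
            sval X = range nu ->
            c b X <> i.

End Trees.

(* Main.v *)
Require Import Defs.
From mathcomp Require Import all_boot all_order.
From mathcomp Require Import boolp classical_sets functions cardinality.

Set Implicit Arguments.
Unset Strict Implicit.
Unset Printing Implicit Defensive.

Import Order.TTheory.
(* [bseq] is shadowed by the bounded sequences of [mathcomp.boot.tuple]. *)
Import Defs.

Local Open Scope order_scope.
Local Open Scope classical_set_scope.
Local Open Scope card_scope.

(** Fix well-orderings of the levels and a diamond sequence [A]. Let [S0] be the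
    set of the [x] in [S] at which the guess [A x] (above theta) is cofinal in
    [x]. As [S] does not reflect, induction on [b] gives an injective
    [f b] on [S0] up to [b] with [f b x] in [A x] and [f b x < x]. A pair of
    sequences of length [b] which split at [f b x] receives one of two
    colours [i], [j] that are read off [A x]; which one depends on whether the
    smaller sequence of the pair takes the value 0 or 1 at the splitting point.

    Given a suitable (T, B), pick for each [a] in [B] a node [t] of length [a]
    in T, a colour [i] omitted above (t0, t1) and a colour [j] omitted above
    (t1, t0). As theta < kappa, the pair (i, j) is constant on an unbounded
    [B3] included in [B]. Some [e] in [S] is a limit of [B3] at which [A]
    guesses [B3], [i] and [j]. For [b] in [B] with [e <= b] and [a := f b e],
    the nodes t0 and t1 over [a] have extensions [u], [v] of length [b] in T,
    and the colour of [u, v] is one that T was supposed to omit. *)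

(** * Well-orders: comparability, least elements, induction *)

Lemma well_order_total (T : Type) (R : rel T) :
  wochoice.well_order R -> forall x y, R x y \/ R y x.
Proof.
move=> wo x y.
have [|z [[]]] := wo (fun z => `[<z = x \/ z = y>]).
  by exists x; apply/asboolP; left.
move=> /asboolP[->|->] lb _; [left|right].
  by apply: lb; apply/asboolP; right.
by apply: lb; apply/asboolP; left.
Qed.

(** Both [x] and [y] would be least in the pair they form, and least elements are unique. *)
Lemma well_order_anti (T : Type) (R : rel T) :
  wochoice.well_order R -> forall x y, R x y -> R y x -> x = y.
Proof.
move=> wo x y Rxy Ryx.
have Rxx z : R z z by case: (well_order_total wo z z).
have [|z [_ min_uniq]] := wo (fun z => `[<z = x \/ z = y>]).
  by exists x; apply/asboolP; left.
rewrite -(min_uniq x) ?(min_uniq y) //; split; do ?[by apply/asboolP; tauto].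
  by move=> t /asboolP[->|->].
by move=> t /asboolP[->|->].
Qed.

Section WellOrderedType.
Context {d : Order.disp_t} {K : orderType d}.
Hypothesis K_wo : wochoice.well_order (<=%O : rel K).

Lemma wo_least (P : set K) :
  P !=set0 -> exists2 m, P m & forall x, P x -> m <= x.
Proof.
move=> [x Px]; have [|m [[/asboolP Pm lb] _]] := K_wo (A := fun z => `[<P z>]).
  by exists x; apply/asboolP.
by exists m => // y Py; apply: lb; apply/asboolP.
Qed.

Lemma wo_ind (P : K -> Prop) :
  (forall a, (forall x, x < a -> P x) -> P a) -> forall a, P a.
Proof.
move=> step a; apply: contrapT => nPa.
have [|m nPm lb] := @wo_least [set x | ~ P x]; first by exists a.
apply: nPm; apply: step => x xm; apply: contrapT => /lb.
by rewrite leNgt xm.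
Qed.

End WellOrderedType.

(** * Regressive injections on subsets of a non-reflecting set *)

Section Transversals.
Context {d : Order.disp_t} {K : orderType d}.
Hypothesis K_wo : wochoice.well_order (<=%O : rel K).
Variables (G : K -> set K) (S : set K).

(** The lower bound [s] keeps the values chosen on one block of an interval away from earlier
    blocks, so that transversals can be glued. *)
Definition transversal_above (s : K) (D : set K) (f : K -> K) : Prop :=
  (forall x, D x -> [/\ G x (f x), s < f x & f x < x]) /\
  (forall x y, D x -> D y -> f x = f y -> x = y).

(** The points of [C] cut the interval into blocks, and one given transversal is used on each block.
    The second hypothesis says that no point of [S] is a limit of [C], which leaves room for a value
    between [x] and the start of its block. *)
Lemma transversal_glue (g s : K) (C : set K) :
  (forall x, s < x -> x < g -> exists2 c, C c & x <= c /\ c < g) ->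
  (forall x, S x -> s < x -> x < g ->
     exists2 t, s <= t /\ t < x & forall c, C c -> c < x -> c <= t) ->
  (forall h t, h < g -> exists f,
     transversal_above t [set x | [/\ S x, t < x & x <= h]] f) ->
  exists f, transversal_above s [set x | [/\ S x, s < x & x < g]] f.
Proof.
move=> C_cof C_gap trans.
(* [nxt x] and [prv x] delimit the block of [x]: the least point of [C] from [x] on, and the
   supremum of [s] and the points of [C] below [x]. *)
have /choice[nxt nxtP] x : exists m, s < x -> x < g ->
    [/\ C m, x <= m, m < g & forall c, C c -> x <= c -> m <= c].
  have [[sx xg]|nsxg] := pselect (s < x /\ x < g); last first.
    by exists x => sx xg; case: nsxg.
  have [c Cc [xc cg]] := C_cof x sx xg.
  have [|m [Cm xm] lb] := wo_least K_wo (P := [set c | C c /\ x <= c]).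
    by exists c.
  exists m => _ _; split=> //; first by apply: le_lt_trans cg; apply: lb.
  by move=> e Ce xe; apply: lb.
pose gap x t := s <= t /\ forall c, C c -> c < x -> c <= t.
have /choice[prv prvP] x : exists m, S x -> s < x -> x < g ->
    [/\ gap x m, m < x & forall t, gap x t -> m <= t].
  have [[Sx sx xg]|nsxg] := pselect [/\ S x, s < x & x < g]; last first.
    by exists x => Sx sx xg; case: nsxg.
  have [t [st tx] ub] := C_gap x Sx sx xg.
  have [|m gm lb] := wo_least K_wo (P := gap x); first by exists t.
  exists m => _ _ _; split=> //.
  by apply: le_lt_trans tx; apply: lb.
have /choice[F FP] (p : K * K) : exists f, p.2 < g ->
    transversal_above p.1 [set x | [/\ S x, p.1 < x & x <= p.2]] f.
  have [/trans tr|] := boolP (p.2 < g); last by exists id.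
  by have [f] := tr p.1; exists f.
pose f x := F (prv x, nxt x) x.
have fP x : S x -> s < x -> x < g ->
    [/\ G x (f x), prv x < f x & f x < x].
  move=> Sx sx xg; have [_ px _] := prvP x Sx sx xg.
  have [_ xn ng _] := nxtP x sx xg.
  by apply: (FP (prv x, nxt x) ng).1.
have f_lt x y : S x -> s < x -> x < y -> S y -> y < g -> f x <> f y.
  move=> Sx sx xy Sy yg.
  have xg := lt_trans xy yg; have sy := lt_trans sx xy.
  have [Cn xn ng nmin] := nxtP x sx xg.
  have [Cm yn mg mmin] := nxtP y sy yg.
  have [gapx px pmin] := prvP x Sx sx xg.
  have [gapy py qmin] := prvP y Sy sy yg.
  have [_ _ fx] := fP x Sx sx xg.
  have [_ fy _] := fP y Sy sy yg.
  (* If [nxt x < y], then [f x < nxt x <= prv y < f y]; otherwise [x] and [y] share a block. *)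
  have [ny|yn'] := ltP (nxt x) y.
    have nq := gapy.2 _ Cn ny; move=> fxy; move: (lt_le_trans fx xn).
    by rewrite fxy ltNge (le_trans nq (ltW fy)).
  have nn : nxt x = nxt y.
    by apply/le_anti; rewrite nmin ?mmin // (le_trans (ltW xy)).
  have pp : prv x = prv y.
    apply/le_anti/andP; split.
      apply: pmin; split=> [|c Cc cx]; first exact: gapy.1.
      by apply: gapy.2 => //; apply: lt_trans xy.
    apply: qmin; split=> [|c Cc cy]; first exact: gapx.1.
    have [cx|xc] := ltP c x; first exact: gapx.2.
    by have := lt_le_trans cy yn'; rewrite ltNge nmin.
  rewrite /f -pp -nn => fxy; move: (xy); rewrite (_ : x = y) ?ltxx //.
  apply: (FP (prv x, nxt x) ng).2 => //; split=> //=.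
  exact: lt_trans xy.
exists f; split=> [x [Sx sx xg]|x y [Sx sx xg] [Sy sy yg] fxy].
  have [[sp _] _ _] := prvP x Sx sx xg; have [Gf pf fx] := fP x Sx sx xg.
  by split=> //; apply: le_lt_trans pf.
by case: (ltgtP x y) => // [/f_lt|/f_lt] /(_ _ _)[].
Qed.

(** A countable cofinal set can be thinned to one with finitely many points below each [x < g]. It
    has no limit below [g], so it can serve as the set of cuts. *)
Lemma transversal_countable_cofinality (g s : K) :
  ~ uncountable_cofinality g ->
  (forall h t, h < g -> exists f,
     transversal_above t [set x | [/\ S x, t < x & x <= h]] f) ->
  exists f, transversal_above s [set x | [/\ S x, s < x & x < g]] f.
Proof.
move=> /existsNP[X /not_implyP[[Xg X_cof] /contrapT X_cnt]].
(* An empty cofinal set leaves nothing below [g]; otherwise [e] enumerates [X]. *)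
case/pfcard_geP: X_cnt => [X0|[e]].
  move=> _; exists id; split=> [x [_ _ xg]|x y [_ _ xg]].
    by have [b] := X_cof x xg; rewrite X0.
  by have [b] := X_cof x xg; rewrite X0.
have eX n : X (e n) by apply: (@funS _ _ setT X e).
(* The strict running maxima of [e]. If [x <= e N], every record below [x] has an index less than
   [N]. *)
pose record := [set c | exists2 n, c = e n & forall k, (k < n)%N -> e k < e n].
have e_cof x : x < g ->
    exists2 N, x <= e N & forall k, (k < N)%N -> e k < x.
  move=> xg; have [b Xb xb] := X_cof x xg.
  have [n _ enb] := @surj _ _ setT X e _ Xb.
  have [|N xN Nmin] := @find_ex_minn (fun n => x <= e n).
    by exists n; rewrite enb.
  exists N => // k kN; rewrite ltNge; apply/negP => /Nmin.
  by rewrite leqNgt kN.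
apply: (@transversal_glue g s record) => x.
  move=> sx xg; have [N xN Nmin] := e_cof x xg.
  exists (e N); last by split=> //; exact: (Xg _ (eX N)).
  by exists N => // k /Nmin ek; apply: lt_le_trans xN.
move=> Sx sx xg; have [N xN _] := e_cof x xg.
suff [t st ub] : exists2 t, s <= t /\ t < x &
    forall n, (n < N)%N -> e n < x -> e n <= t.
  exists t => // c [n -> rec] enx; apply: ub => //.
  rewrite ltnNge leq_eqVlt; apply/negP => /orP[/eqP Nn|/rec].
    by move: enx; rewrite -Nn ltNge xN.
  by rewrite ltNge (le_trans (ltW enx)).
elim: N {xN} => [|N [t [st tx] ub]]; first by exists s.
have [eNx|xeN] := ltP (e N) x.
  exists (Order.max t (e N)); first by rewrite le_max st gt_max tx.
  move=> n; rewrite ltnS leq_eqVlt => /orP[/eqP-> _|nN enx].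
    by rewrite le_max lexx orbT.
  by rewrite le_max ub.
exists t => // n; rewrite ltnS leq_eqVlt => /orP[/eqP-> |/ub//].
by rewrite ltNge xeN.
Qed.

(** Induction on [g], for all [s] at once. At uncountable cofinality, non-reflection gives a club
    [C] of [g] that misses [S1]. The points of [S] above [s] are limits, so by closedness [C] cannot
    be cofinal in any of them, and its points can serve as cuts. *)
Lemma transversal_exists (S1 : set K) :
  nonreflecting S1 -> S `<=` S1 ->
  (forall x, S x -> forall y, y < x -> exists2 z, G x z & y < z /\ z < x) ->
  forall g s, exists f,
    transversal_above s [set x | [/\ S x, s < x & x <= g]] f.
Proof.
move=> nrS1 SS1 G_cof; apply: (wo_ind K_wo) => g IH.
have IHt h t : h < g -> exists f,
    transversal_above t [set x | [/\ S x, t < x & x <= h]] f.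
  by move=> hg; apply: IH.
have opn s : exists f, transversal_above s [set x | [/\ S x, s < x & x < g]] f.
  have [ucg|] := pselect (uncountable_cofinality g); last first.
    by move=> ncg; apply: transversal_countable_cofinality.
  have nstat : ~ stationary (below g) (S1 `&` below g).
    by move=> st; apply: nrS1; exists g.
  have [C [[[Cg C_cof] C_cl] SC]] :
      exists C, club (below g) C /\ ~ (S1 `&` below g `&` C !=set0).
    apply: contrapT => nC; apply: nstat; split=> [x []//|C Cclub].
    by apply: contrapT => SC; apply: nC; exists C.
  apply: (@transversal_glue g s C) => // x.
    move=> sx xg; have [c Cc xc] := C_cof x xg.
    by exists c => //; split=> //; apply: Cg.
  move=> Sx sx xg; apply: contrapT => ngap; apply: SC; exists x.
  split; first by split=> //; apply: SS1.
  apply: C_cl => //.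
    split=> [|y yx]; first by exists s.
    by have [z _ [yz zx]] := G_cof x Sx y yx; exists z.
  split=> [y []//|y yx]; apply: contrapT => nc; apply: ngap.
  exists (Order.max s y); first by rewrite le_max lexx gt_max sx.
  move=> c Cc cx; rewrite le_max; apply/orP; right.
  by rewrite leNgt; apply/negP => yc; apply: nc; exists c => //; apply: ltW.
move=> s; have [[Sg sg]|nSg] := pselect (S g /\ s < g); last first.
  have [f [f1 f2]] := opn s; exists f.
  rewrite (_ : [set x | _] = [set x | [/\ S x, s < x & x < g]]) //.
  apply/seteqP; split=> x [Sx sx xg]; split=> //; last exact: ltW.
  by rewrite lt_neqAle xg andbT; apply/eqP => xg'; subst x; apply: nSg.
(* The value z at g separates the values below z from those above z. *)
have [z Gz [sz zg]] := G_cof g Sg s sg.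
have [f1 [f1P f1i]] := IHt z s zg; have [f2 [f2P f2i]] := opn z.
pose f x := if x <= z then f1 x else if x < g then f2 x else z.
have fP1 x : S x -> s < x -> x <= z -> [/\ G x (f x), s < f x, f x < x & f x < z].
  move=> Sx sx xz; rewrite /f xz.
  have [Gf sf fx] : [/\ G x (f1 x), s < f1 x & f1 x < x] by apply: f1P.
  by split=> //; apply: lt_le_trans xz.
have fP2 x : S x -> z < x -> x < g -> [/\ G x (f x), z < f x & f x < x].
  by move=> Sx zx xg; rewrite /f leNgt zx xg; apply: f2P.
have fg : f g = z by rewrite /f leNgt zg ltxx.
have key x : S x -> s < x -> x <= g ->
    [\/ x <= z, z < x /\ x < g | x = g].
  move=> Sx sx; rewrite le_eqVlt => /orP[/eqP->|xg]; first by apply: Or33.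
  by have [xz|zx] := leP x z; [apply: Or31|apply: Or32].
exists f; split=> [x [Sx sx xg]|x y [Sx sx xg] [Sy sy yg] fxy].
  case: (key x Sx sx xg) => [xz|[zx xg']|->].
  - by have [] := fP1 x Sx sx xz.
  - have [Gf zf fx] := fP2 x Sx zx xg'; split=> //; exact: lt_trans zf.
  - by rewrite fg.
have f_neq a b : f a < z -> z <= f b -> f a <> f b.
  by move=> az zb ab; move: az; rewrite ab ltNge zb.
case: (key x Sx sx xg) => [xz|[zx xg']|xg'];
case: (key y Sy sy yg) => [yz|[zy yg']|yg'].
- by apply: f1i => //; move: fxy; rewrite /f xz yz.
- have [_ _ _ fx] := fP1 x Sx sx xz; have [_ fy _] := fP2 y Sy zy yg'.
  by case: (f_neq x y) => //; apply: ltW.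
- have [_ _ _ fx] := fP1 x Sx sx xz.
  by case: (f_neq x y) => //; rewrite yg' fg.
- have [_ _ _ fy] := fP1 y Sy sy yz; have [_ fx _] := fP2 x Sx zx xg'.
  by case: (f_neq y x) => //; apply: ltW.
- by apply: f2i => //; move: fxy; rewrite /f !leNgt zx zy xg' yg'.
- have [_ fx _] := fP2 x Sx zx xg'.
  by move: fx; rewrite fxy yg' fg ltxx.
- have [_ _ _ fy] := fP1 y Sy sy yz.
  by case: (f_neq y x) => //; rewrite xg' fg.
- have [_ fy _] := fP2 y Sy zy yg'.
  by move: fy; rewrite -fxy xg' fg ltxx.
- by rewrite xg' yg'.
Qed.

End Transversals.

(** * Regular uncountable cardinals: bounds, pigeonhole, clubs *)

Section RegularCardinals.
Context {d : Order.disp_t} {K : orderType d}.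
Hypothesis K_regular : is_regular_cardinal K.
Hypothesis K_uncountable : ~ countable [set: K].

Definition unbounded (A : set K) : Prop := forall a, exists2 b, A b & a < b.

(** The first conjunct excludes the least element, where the second is vacuous. *)
Definition accumulation (A : set K) (x : K) : Prop :=
  (exists y, y < x) /\ forall y, y < x -> exists2 z, A z & y < z /\ z < x.

Lemma card_neq_bounded (X : set K) :
  ~ (X #= [set: K]) -> exists b, forall x, X x -> x < b.
Proof.
move=> nX; apply: contrapT => nb; apply: nX; apply: K_regular.2; split=> // a _.
apply: contrapT => na; apply: nb; exists a => x Xx.
by rewrite ltNge; apply/negP => ax; apply: na; exists x.
Qed.

Lemma countable_bounded (X : set K) :
  countable X -> exists b, forall x, X x -> x < b.
Proof.
move=> Xc; apply: card_neq_bounded => /eq_countable XK.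
by apply: K_uncountable; rewrite -XK.
Qed.

Lemma below_image_bounded (a : K) (f : K -> K) :
  exists b, forall x, x < a -> f x < b.
Proof.
have [eK|b bP] := @card_neq_bounded (f @` below a); last first.
  by exists b => x xa; apply: bP; exists x.
apply: (K_regular.1.2 a).2; rewrite -(card_le_eql eK).
exact: card_image_le.
Qed.

Lemma no_maximum (a : K) : exists b, a < b.
Proof. by have [b bP] := countable_bounded (countable1 a); exists b; apply: bP. Qed.

Lemma succ_exists (a : K) : exists b, is_succ a b.
Proof.
by have [b ab bmin] := wo_least K_regular.1.1 (no_maximum a); exists b.
Qed.

Lemma card_full_unbounded (A : set K) : A #= [set: K] -> unbounded A.
Proof.
move=> AK a; apply: contrapT => nA.
have [b ab] := no_maximum a; apply: (K_regular.1.2 b).2.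
rewrite -(card_le_eql AK); apply: subset_card_le => x Ax /=.
apply: le_lt_trans ab; rewrite leNgt; apply/negP => ax.
by apply: nA; exists x.
Qed.

(** Pigeonhole: if every fibre were bounded, regularity would bound the fewer than kappa bounds, and
    hence [A]. *)
Lemma unbounded_fiber (t : K) (A : set K) (j : K -> K) :
  unbounded A -> (forall x, A x -> j x < t) ->
  exists i, unbounded (A `&` [set x | j x = i]).
Proof.
move=> A_unb jt; apply: contrapT => nfib.
have /choice[g gP] i : exists b, forall x, A x -> j x = i -> x <= b.
  apply: contrapT => ni; apply: nfib; exists i => a.
  apply: contrapT => na; apply: ni; exists a => x Ax jx.
  by rewrite leNgt; apply/negP => ax; apply: na; exists x.
have [b gb] := below_image_bounded t g.
have [x Ax bx] := A_unb b.
have := lt_trans bx (le_lt_trans (gP _ x Ax erefl) (gb _ (jt x Ax))).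
by rewrite ltxx.
Qed.

(** For cofinality, let [h] step to a larger point of [A] and iterate it omega times from [max a t].
    The supremum exists since countable sets are bounded, and it is an accumulation point. *)
Lemma club_accumulation (t : K) (A : set K) :
  unbounded A -> club setT [set x | t < x /\ accumulation A x].
Proof.
move=> A_unb; have /choice[h hP] a : exists b, A b /\ a < b.
  by have [b] := A_unb a; exists b.
split.
  split=> // a _; pose s n := iter n h (Order.max a t).
  have [|b bP] := @countable_bounded (range s).
    by apply: sub_countable (card_image_le _ _) _; apply: countableP.
  have [|m mP mmin] := wo_least K_regular.1.1 (P := [set x | forall n, s n < x]).
    by exists b => n; apply: bP; exists n.
  have := mP 0%N; rewrite /s /= gt_max => /andP[am tm].
  exists m; last exact: ltW.
  split=> //; split=> [|y ym]; first by exists a.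
  have [n yn] : exists n, y <= s n.
    apply: contrapT => ny; move: ym; rewrite ltNge => /negP; apply; apply: mmin.
    by move=> n; rewrite ltNge; apply/negP => yn; apply: ny; exists n.
  exists (s n.+1); first exact: (hP (s n)).1.
  by split=> //; apply: le_lt_trans yn _; exact: (hP (s n)).2.
move=> g _ [[x xg] g_lim] [_ cof]; split.
  by have [b [[tb _] bg] _] := cof x xg; apply: lt_trans bg.
split=> [|y yg]; first by exists x.
have [y1 yy1 y1g] := g_lim y yg.
have [b [[_ [_ accb]] /= bg] y1b] := cof y1 y1g.
have [z Az [yz zb]] := accb y (lt_le_trans yy1 y1b).
by exists z => //; split=> //; apply: lt_trans bg.
Qed.

End RegularCardinals.

(** * Tree nodes, splitting points and coded pairs of colours *)

Section TreeNodes.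
Context {d : Order.disp_t} {K : orderType d}.

Lemma regular_subtree_extend (T : seqset (K := K)) a b (eta : bseq a) :
  regular_subtree T -> T a eta -> a <= b ->
  exists2 nu : bseq b, T b nu & initial eta nu.
Proof.
by move=> [_ ext _] Teta ab; have := ext a eta b Teta; rewrite (max_idPr ab).
Qed.

Lemma regular_subtree_level (T : seqset (K := K)) a :
  regular_subtree T -> exists t : bseq a, T a t.
Proof.
move=> rT; have [[[a0 [eta Teta]] down] ext _] := rT.
have [nu Tnu _] := ext a0 eta a Teta.
have aM : a <= Order.max a0 a by rewrite le_max lexx orbT.
by exists (restr aM nu); apply: down Tnu; exists aM.
Qed.

Lemma initial_append (a a1 b : K) (t : bseq a) i (nu : bseq b) :
  a < a1 -> initial (append (b := a1) t i) nu ->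
  (forall z : seg b, val z = a -> nu z = i) /\
  (forall (z : seg b) (za : val z < a), nu z = t (exist _ (val z) za)).
Proof.
move=> aa1 [a1b eq_nu].
have nuE (z : seg b) (za1 : val z < a1) :
    nu z = append (b := a1) t i (exist _ (val z) za1).
  rewrite eq_nu /restr; congr nu; exact: val_inj.
split=> [z za|z za].
  have za1 : val z < a1 by rewrite za.
  rewrite (nuE z za1) /append /=; case: insubP => //= u.
  by rewrite za ltxx.
rewrite (nuE z (lt_trans za aa1)) /append /=; case: insubP => [u _ uz|].
  by congr t; apply: val_inj.
by rewrite za.
Qed.

Lemma append_false_neq_true (a a1 : K) (t : bseq a) : a < a1 ->
  append (b := a1) t false <> append (b := a1) t true.
Proof.
move=> aa1 /(congr1 (fun f => f (exist _ a aa1))).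
by rewrite /append; case: insubP => //= u; rewrite ltxx.
Qed.

Definition split_at (b : K) (x y : bseq b) (z : seg b) : Prop :=
  x z <> y z /\ forall w : seg b, val w < val z -> x w = y w.

Lemma split_at_uniq (b : K) (x y : bseq b) z1 z2 :
  split_at x y z1 -> split_at x y z2 -> z1 = z2.
Proof.
move=> [n1 e1] [n2 e2]; apply: val_inj.
by case: (ltgtP (val z1) (val z2)) => // [/e2|/e1].
Qed.

(* [X] below [t] is the unordered pair {i, j}; [X t] records which is which. *)
Definition codes (t : K) (X : set K) (i j : seg t) : Prop :=
  (forall z, z < t -> X z <-> z = val i \/ z = val j) /\
  (X t <-> val i <= val j).

(** The members below [t] determine the unordered pair. If the two pairs were swapped, the bit at
    [t] would force both colours to be equal. *)
Lemma codes_uniq t X (i j i' j' : seg t) :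
  codes X i j -> codes X i' j' -> i = i' /\ j = j'.
Proof.
move=> [X1 X2] [X1' X2'].
have oij : val i <= val j <-> val i' <= val j' by rewrite -X2 -X2'.
have mem z : z < t -> z = val i \/ z = val j <-> z = val i' \/ z = val j'.
  by move=> zt; rewrite -X1 // -X1'.
have mi := (mem _ (valP i)).1 (or_introl erefl).
have mj := (mem _ (valP j)).1 (or_intror erefl).
have mi' := (mem _ (valP i')).2 (or_introl erefl).
have mj' := (mem _ (valP j')).2 (or_intror erefl).
suff [vi vj] : val i = val i' /\ val j = val j' by split; apply: val_inj.
move: oij mi mj mi' mj'; clear.
move: (val i) (val j) (val i') (val j') => a b a' b' o.
case=> ea [] eb.
- by rewrite ea eb => _ [].
- by rewrite ea eb.
- move=> _ _; move: o; rewrite -ea -eb.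
  by case: (ltgtP a b) => // _ [h h']; [have := h isT|have := h' isT].
- by rewrite ea eb => -[->|->].
Qed.

End TreeNodes.

Lemma card_eq_set2 (T : Type) (x y : T) : x <> y -> [set x; y] #= `I_2.
Proof.
move=> xy; apply/eq_cardSP; exists x; first by left.
rewrite (_ : _ `\ x = [set y]) ?card_set1 //.
apply/seteqP; split=> z /=; first by case=> [[]].
by move=> ->; split; [right|move=> yx; apply: xy].
Qed.

(** Recovers the increasing enumeration of an unordered pair of sequences, on which its colour will
    depend. *)
Lemma set2_ordered (T : Type) (R : rel T) (x y x' y' : T) :
  (forall x y, R x y -> R y x -> x = y) -> x <> y -> R x y -> R x' y' ->
  [set x; y] = [set x'; y'] -> x = x' /\ y = y'.
Proof.
move=> R_anti xy Rxy Rxy' E.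
have [/= xx'|/= xy'] : [set x'; y'] x by rewrite -E; left.
  have [/= yx'|/= yy'] : [set x'; y'] y by rewrite -E; right.
    by case: xy; rewrite xx'.
  by [].
have [/= yx'|/= yy'] : [set x'; y'] y by rewrite -E; right.
  by case: xy; apply: R_anti => //; rewrite xy' yx'.
by case: xy; rewrite xy'.
Qed.

(** * The colouring, and why no suitable triple omits colours *)

Theorem theorem1p7 (d : Order.disp_t) (K : orderType d)
    (K_inaccessible : strongly_inaccessible K)
    (S : set K) (S_stationary : stationary setT S)
    (S_nonreflecting : nonreflecting S) (S_diamond : diamond S)
    (theta : K) (theta_ge2 : `I_2 #<= below theta) :
  ~ HLplus 2 theta.
Proof.
have [K_reg K_unc _] := K_inaccessible; have K_wo := K_reg.1.1.
have [A _ A_guess] := S_diamond.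
(* A colour to use where nothing prescribes one. *)
have [i_default _] : exists i : seg theta, True.
  case/card_leP: theta_ge2 => e.
  have in0 : 0%N \in `I_2 by apply/mem_set.
  by exists (exist _ _ (set_valP (e (SigSub in0)))).
(* The guess at [x] is meant to code two colours at and below [theta] and a set of levels above it;
   [G x] is the set of levels. *)
pose G x := A x `&` [set z | theta < z].
pose S0 := [set x | S x /\ accumulation (G x) x].
(* With the least element as lower bound, the transversals cover all of [S0] up to [b]. *)
have [o _ o_min] := wo_least K_wo (P := setT) (ex_intro _ theta I).
have /choice[f fP] b : exists f,
    transversal_above G o [set x | [/\ S0 x, o < x & x <= b]] f.
  apply: (transversal_exists K_wo S_nonreflecting) => [x []//|x [_ [_ acc]]].
  exact: acc.
have o_lt x : S0 x -> o < x.
  by move=> [_ [[y yx] _]]; apply: le_lt_trans yx; apply: o_min.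
have wop (a : K) := wochoice.well_ordering_principle {eclassic (bseq a)}.
pose le_ (a : K) : rel (bseq a) := sval (wop a).
have le_wo (a : K) : wochoice.well_order (le_ a) by exact: (svalP (wop a)).
pose rule b (X : nsubset 2 (bseq b)) (k : seg theta) :=
  exists (x y : bseq b) (z : seg b) (e : K) (i j : seg theta),
  [/\ sval X = [set x; y], x <> y /\ le_ b x y, split_at x y z,
      [/\ S0 e, e <= b & f b e = val z] &
      codes (A e) i j /\ k = if x z then j else i].
(* The order of the level determines [x] and [y], their first difference [z], injectivity of [f b]
   then [e], and the guess at [e] the two colours. *)
have rule_uniq b X k k' : @rule b X k -> @rule b X k' -> k = k'.
  move=> [x [y [z [e [i [j [Xxy [xy lexy] xyz [S0e eb fe] [cij ->]]]]]]]].
  move=> [x' [y' [z' [e' [i' [j' [Xxy' [xy' lexy'] xyz' [S0e' eb' fe'] [cij' ->]]]]]]]].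
  have [exx eyy] : x = x' /\ y = y'.
    apply: (set2_ordered (well_order_anti (le_wo b))) => //.
    by rewrite -Xxy -Xxy'.
  subst x' y'; have ez := split_at_uniq xyz xyz'; subst z'.
  have ee : e = e'.
    apply: (fP b).2; [by split=> //; apply: o_lt..|].
    by rewrite fe fe'.
  by subst e'; have [-> ->] := codes_uniq cij cij'.
(* Level and pair are packed into one argument so that choice yields a single function. *)
have /choice[c0 c0P] (p : {b : K & nsubset 2 (bseq b)}) :
    exists k, forall k', rule (projT1 p) (projT2 p) k' -> k = k'.
  have [[k rk]|nk] := pselect (exists k, rule (projT1 p) (projT2 p) k).
    by exists k => k'; apply: rule_uniq.
  by exists i_default => k' rk; case: nk; exists k'.
pose c b X := c0 (existT _ b X).
have cP b X k : rule b X k -> c b X = k by apply: (c0P (existT _ b X)).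
move=> /(_ le_ c le_wo)[T [B [[B_card T_reg T_split] omit]]].
have B_unb := card_full_unbounded K_reg K_unc B_card.
have /choice[nxt nxtP] := succ_exists K_reg K_unc.
pose omitted a (x y : bseq a) i := forall b (u v : bseq b) X, B b ->
  T b u -> T b v -> a < b -> initial x u -> initial y v ->
  le_ b u v -> u <> v -> sval X = [set u; v] -> c b X <> i.
have omit2 a (x y : bseq a) : T a x -> T a y -> x <> y ->
    exists i, omitted a x y i.
  move=> Tx Ty xy.
  pose pair2 (U : Type) (u v : U) (l : 'I_2) := if val l is 0%N then u else v.
  have [||i iP] := omit a (pair2 _ x y).
  - by case=> -[|[|]].
  - case=> -[|[|//]] m; case=> -[|[|//]] m' /= xy';
      by [exact: val_inj|case: xy].
  exists i => b u v X Bb Tu Tv ab xu yv uv nuv Xuv.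
  apply: (iP b (pair2 _ u v)) => //.
  - by case=> -[|[|//]] m.
  - by case=> -[|[|//]] m; case=> -[|[|//]].
  rewrite Xuv; apply/seteqP; split=> z.
    by case=> ->; [exists ord0|exists ord_max].
  by move=> [[[|[|//]] m] _ <-]; [left|right].
have /choice[J JP] a : exists p : seg theta * seg theta, B a ->
    exists t : bseq a, let u i := append (b := nxt a) t i in
    [/\ forall i, T (nxt a) (u i), omitted _ (u false) (u true) p.1
      & omitted _ (u true) (u false) p.2].
  have [Ba|nBa] := pselect (B a); last by exists (i_default, i_default).
  have [t Tt] := regular_subtree_level a T_reg.
  have Tu := (T_split a t (nxt a) Tt (nxtP a)).2 Ba.
  have ft := append_false_neq_true (t := t) (nxtP a).1.
  have [i iP] := omit2 _ _ _ (Tu false) (Tu true) ft.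
  have [j jP] := omit2 _ _ _ (Tu true) (Tu false) (nesym ft).
  by exists (i, j) => _; exists t.
have [vi B1_unb] := unbounded_fiber K_reg B_unb
  (fun x _ => valP (J x).1).
have [vj B2_unb] := unbounded_fiber K_reg B1_unb
  (fun x _ => valP (J x).2).
(* [vi] and [vj] are mere elements of [K]; the member [x0] provides the colours as elements of
   [seg theta]. *)
have [x0 [[_ /= vi_def] /= vj_def] _] := B2_unb theta.
pose i := (J x0).1; pose j := (J x0).2.
have B2J x : (B `&` [set x | val (J x).1 = vi] `&` [set x | val (J x).2 = vj]) x ->
    B x /\ J x = (i, j).
  move=> [[Bx /= xi] /= xj]; split=> //; rewrite [J x]surjective_pairing.
  by congr pair; apply: val_inj; rewrite /= ?xi ?xj ?vi_def ?vj_def.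
move: B2_unb B2J; set B2 := _ `&` _ `&` _ => B2_unb B2J.
pose B3 := B2 `&` [set x | theta < x].
have B3_unb : unbounded B3.
  move=> a; have [b B2b] := B2_unb (Order.max a theta).
  by rewrite gt_max => /andP[ab tb]; exists b.
(* Three disjoint layers: levels above [theta], colours below it, and at [theta] the bit that orders
   the colours. *)
pose X := B3 `|` [set x | x = val i \/ x = val j]
             `|` [set x | x = theta /\ val i <= val j].
(* Since [theta < e], the guess at [e] contains the whole code; as a limit of [B3], [e] will lie in
   [S0]. *)
have [e [[Se eX] [te acc]]] :=
  (A_guess X).2 _ (club_accumulation K_reg K_unc theta B3_unb).
have AeE z : z < e -> A e z <-> X z.
  by move=> ze; rewrite -eX; split=> [[]|].
have codes_e : codes (A e) i j.
  have tN x : x <= theta -> ~ B3 x by move=> xt [_ /=]; rewrite ltNge xt.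
  split=> [z zt|].
    rewrite AeE; last exact: lt_trans te.
    split=> [[[/tN[]|//]|[/= zth _]]|zij]; first exact: ltW.
      by move: zt; rewrite zth ltxx.
    by left; right.
  rewrite AeE //; split=> [[[/tN[]//|]|[]//]|ij]; last by right.
  by case=> /= E; [have := valP i|have := valP j]; rewrite /= -E ltxx.
have Ge z : z < e -> G e z -> B3 z.
  move=> ze [/(AeE z ze)[[//|]|] /=].
    by case=> ->; rewrite ltNge ltW //; [apply: (valP i)|apply: (valP j)].
  by case=> ->; rewrite ltxx.
have S0e : S0 e.
  split=> //; split; first by case: acc.
  move=> y ye; have [z B3z [yz ze]] := acc.2 y ye.
  exists z => //; split; last by case: B3z.
  by apply/(AeE z ze); left; left.
have [b Bb /ltW eb] := B_unb e.
have [Gfe _ fe] : [/\ G e (f b e), o < f b e & f b e < e].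
  by apply: (fP b).1; split=> //; apply: o_lt.
set a := f b e in Gfe fe.
have [Ba Ja] := B2J a (Ge a fe Gfe).1.
have [t [Tu om_i om_j]] := JP a Ba; rewrite Ja /= in om_i om_j.
have [aa1 a1min] := nxtP a.
have ab : a < b := lt_le_trans fe eb.
(* A point strictly between [a] and [e] puts the successor of [a] below [b], so that the nodes of
   length [nxt a] have proper extensions of length [b]. *)
have [a2 _ [aa2 a2e]] := acc.2 a fe.
have a1b : nxt a < b.
  by apply: le_lt_trans (a1min a2 aa2) _; apply: lt_le_trans eb.
have [u Tub uI] := regular_subtree_extend T_reg (Tu false) (ltW a1b).
have [v Tvb vI] := regular_subtree_extend T_reg (Tu true) (ltW a1b).
have [u_a u_lt] := initial_append aa1 uI.
have [v_a v_lt] := initial_append aa1 vI.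
pose z : seg b := exist _ a ab.
have uz : u z = false by apply: u_a.
have vz : v z = true by apply: v_a.
have uvz : split_at u v z.
  split=> [|w wz]; first by rewrite uz vz.
  by rewrite (u_lt w wz) (v_lt w wz).
have vuz : split_at v u z.
  by case: uvz => ne lt; split=> [|w /lt//]; apply: nesym.
have uv : u <> v by move=> E; move: uz; rewrite E vz.
pose Y : nsubset 2 (bseq b) := exist _ [set u; v] (card_eq_set2 uv).
(* The smaller sequence takes the value 0 or 1 at [z], which gives the colour [i] or [j]: in each
   case the one omitted for that order. *)
have [le_uv|le_vu] := well_order_total (le_wo b) u v.
  apply: (om_i b u v Y) => //; apply: cP.
  by exists u, v, z, e, i, j; split=> //; rewrite uz.
apply: (om_j b v u Y) => //; first exact: nesym.
  by rewrite /= setUC.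
apply: cP; exists v, u, z, e, i, j; split=> //=.
- by rewrite setUC.
- by split=> //; apply: nesym.
- by rewrite vz.
Qed.
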